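(* Let $\mathbf{p}=(p_i)_i$ be a probability distribution on a finite or countably infinite set of colors. Then the derived distributions of $X(\mathbf{p})$ (Method 1) and $Y(\mathbf{p})$ (Method 2) are equal, i.e. $\mathbb{P}(X=i)=\mathbb{P}(Y=i)$ for every color $i$, if and only if $\mathbf{p}$ is a uniform distribution.
   Context: Colors are labelled by $\{0,1,\dots,n\}$ or by $\{0,1,2,\dots\}$, and $p_i\ge 0$, $\sum_i p_i=1$; $p_i$ is the probability that a single randomly chosen sock has color $i$. Socks are sampled independently from $\mathbf{p}$. Method 1: $X=X(\mathbf{p})$ is the color of a pair of independent socks conditional on the two colors matching, i.e. with $f_2=\sum_i p_i^2$, $$\mathbb{P}(X=i)=\frac{p_i^2}{f_2}.$$ Method 2: socks are picked one at a time until for the first time some color has been seen twice; $Y=Y(\mathbf{p})$ is that color. Explicitly, $$\mathbb{P}(Y=i)=p_i^2\sum_{k\ge 0}(k+1)!\sum_{J:\,|J|=k,\ i\notin J}\ \prod_{j\in J}p_j ,$$ where the inner sum is over all sets $J$ of $k$ distinct colors not containing $i$ (the empty product is $1$). A discrete distribution $\mathbf{p}$ is called uniform if it has finite support and $p_i=1/m$ for every color $i$ in the support, where $m$ is the size of the support. *)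

(* Defs.v *)
From mathcomp Require Import all_boot all_order all_algebra finmap.
From mathcomp Require Import all_classical all_reals all_analysis.

Set Implicit Arguments.
Unset Strict Implicit.
Unset Printing Implicit Defensive.
Import Order.TTheory GRing.Theory Num.Theory.

Local Open Scope classical_set_scope.
Local Open Scope fset_scope.
Local Open Scope ring_scope.
Local Open Scope ereal_scope.

(* The set of colors is a [countType]: finite or countably infinite. *)

Definition distribution_on (R : realType) (T : countType) (p : T -> R) : Prop :=
  (forall i, (0 <= p i)%R) /\ \esum_(i in [set: T]) (p i)%:E = 1.

Definition support_of (R : realType) (T : countType) (p : T -> R) : set T :=
  [set i | p i != 0%R].

Definition uniform_distribution (R : realType) (T : countType) (p : T -> R)
    : Prop :=
  finite_set (support_of p) /\
  forall i, support_of p i -> p i = ((#|` fset_set (support_of p)|)%:R)^-1%R.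

Definition match_prob (R : realType) (T : countType) (p : T -> R) : \bar R :=
  \esum_(i in [set: T]) (p i ^+ 2)%:E.

(* Law of the common color of two independent socks, conditionally on the two
   colors being equal. *)
Definition lawX (R : realType) (T : countType) (p : T -> R) (i : T) : \bar R :=
  (p i ^+ 2)%:E / match_prob p.

(* Law of the first color to be seen twice when socks are drawn independently.
   [J] is the set of the colors other than [i] seen before the second sock of
   color [i]; these [k] socks and the first sock of color [i] come in any of
   [k.+1`!] orders.  The series is over nonnegative extended reals, and when
   [p i = 0] the value is [0], also if the series diverges, because
   [0 * +oo = 0] in [\bar R]. *)
Definition lawY (R : realType) (T : countType) (p : T -> R) (i : T) : \bar R :=
  (p i ^+ 2)%:E *
  \sum_(0 <= k <oo)
    (((k.+1)`!)%:R)%:E *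
    \esum_(J in [set J : {fset T} | #|` J| = k /\ i \notin J])
      (\prod_(j <- J) p j)%:E.

(* Main.v *)
Require Import Defs.
From mathcomp Require Import all_boot all_order all_algebra.
From mathcomp Require Import all_classical all_reals all_analysis.
From mathcomp Require Import finmap ring.

(** Dividing P(Y = i) by [p i ^+ 2] leaves the weight
      A_i = \sum_k (k+1)! e_k(p without i),
    where e_k is the k-th elementary symmetric sum, while dividing P(X = i)
    by [p i ^+ 2] leaves the constant 1 / f_2.  So the two laws agree exactly
    when A_i = 1 / f_2 for every color i of the support.

    Equal laws force uniformity.  Take two colors i and j of the support.
    Sorting the sets that avoid i by whether they contain j gives
      e_k(without i) = e_k(without i, j) + p_j e_(k-1)(without i, j)
    ([elem_symS]), hence A_i = a + p_j s, where a and s depend only on the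
    unordered pair {i, j} ([repeat_weightE]).  In the same way
    A_j = a + p_i s.  Since s >= 2, and s is finite as soon as A_i is,
    A_i = A_j gives p_i = p_j ([repeat_weight_inj]).  So p is constant on its
    support, and total mass 1 makes the support finite and the constant the
    inverse of its size ([uniform_of_constant]).

    Conversely, if p is uniform on m colors then e_k(without i) is
    'C(m-1, k) / m^k ([elem_sym_uniform]), and A_i = m = 1 / f_2 by the
    birthday identity [birthday_sum], a telescoping sum which says that
    drawing from m colors eventually yields a repetition. *)

Set Implicit Arguments.
Unset Strict Implicit.
Unset Printing Implicit Defensive.
Import Order.TTheory GRing.Theory Num.Theory.

Local Open Scope classical_set_scope.
Local Open Scope fset_scope.
Local Open Scope ring_scope.
Local Open Scope ereal_scope.

(** * Sums of nonnegative extended reals *)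

Lemma ge0_esumZl (R : realType) (I : choiceType) (A : set I) (f : I -> \bar R)
    (r : R) : (0 <= r)%R -> (forall i, 0 <= f i) ->
  \esum_(i in A) (r%:E * f i) = r%:E * \esum_(i in A) f i.
Proof.
move=> r0 f0; rewrite /esum -ereal_supZl //; last first.
  apply/set0P; exists (\sum_(i \in set0) f i); exists set0 => //.
  by split.
congr ereal_sup; rewrite image_comp.
by apply: eq_imagel => X _ /=; rewrite -ge0_mule_fsumr.
Qed.

Lemma esum_finite_support (R : realType) (I : choiceType) (S : set I)
    (f : I -> \bar R) : finite_set S -> (forall i, 0 <= f i) ->
    (forall i, ~ S i -> f i = 0) ->
  \esum_(i in [set: I]) f i = \sum_(i <- fset_set S) f i.
Proof.
move=> Sfin f0 fS; rewrite (esumID S) ?setTI; last by move=> i _; exact: f0.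
rewrite [X in _ + X]esum1 ?adde0; last by move=> i /= /fS.
by rewrite esum_fset // fsbig_finite.
Qed.

(** As [x] is positive, finiteness of the sum makes both [a] and [s] finite. *)
Lemma adde_mul_inj (R : realType) (a s : \bar R) (x y : R) :
  0 <= a -> 0 < s -> (0 < x)%R ->
  a + x%:E * s \is a fin_num -> a + x%:E * s = a + y%:E * s -> x = y.
Proof.
move=> a0 s0 x0; case: a a0 => [a||] // a0; last first.
  have xs : 0 <= x%:E * s by apply: mule_ge0; [rewrite lee_fin|]; exact: ltW.
  by rewrite addye // gt_eqF // (lt_le_trans (ltNyr 0)).
case: s s0 => [s||] // s0; last by rewrite gt0_muley ?lte_fin.
move=> _; rewrite -!EFinM -!EFinD => -[/addrI].
by apply: mulIf; rewrite lt0r_neq0 // -lte_fin.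
Qed.

Lemma pmule_inj (R : realDomainType) (r : R) :
  (0 < r)%R -> injective (fun x : \bar R => r%:E * x).
Proof.
move=> r0 x y rxy; apply/eqP; rewrite eq_le.
by apply/andP; split; rewrite -(@lee_pmul2l _ r%:E) // rxy.
Qed.

(** * Symmetric sums over the sets of colors avoiding given ones *)

Section SymmetricSums.
Variables (R : realType) (T : countType) (p : T -> R).
Hypothesis p_ge0 : forall i, (0 <= p i)%R.

Definition avoiding_sets (D : {fset T}) k : set {fset T} :=
  [set J : {fset T} | #|` J| = k /\ [disjoint J & D]].

(** The elementary symmetric sum of degree [k] in the probabilities of the
    colors outside [D].  Forbidding a whole finite set, rather than the single
    color of Method 2, is what makes the recursion [elem_symS] possible. *)
Definition elem_sym (D : {fset T}) k : \bar R :=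
  \esum_(J in avoiding_sets D k) (\prod_(j <- J) p j)%:E.

Lemma prod_ge0 (J : {fset T}) : 0 <= (\prod_(j <- J) p j)%:E.
Proof. by rewrite lee_fin; apply: prodr_ge0. Qed.

Lemma elem_sym_ge0 D k : 0 <= elem_sym D k.
Proof. by apply: esum_ge0 => J _; exact: prod_ge0. Qed.

Lemma elem_sym0 D : elem_sym D 0 = 1.
Proof.
rewrite /elem_sym (_ : avoiding_sets D 0 = [set fset0]).
  by rewrite esum_set1 ?prod_ge0// big_seq_fset0.
apply/seteqP; split=> J /=; first by case=> /cardfs0_eq.
by move=> ->; split; rewrite ?fdisjoint0X.
Qed.

(** A set avoiding [D] either avoids [i] too, or is [i |` J] for a unique
    smaller set [J] avoiding [i |` D]. *)
Lemma elem_symS (D : {fset T}) i k : i \notin D ->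
  elem_sym D k.+1 = elem_sym (i |` D) k.+1 + (p i)%:E * elem_sym (i |` D) k.
Proof.
move=> iD.
rewrite {1}/elem_sym (esumID [set J : {fset T} | i \notin J]); last first.
  by move=> J _; exact: prod_ge0.
congr (_ + _).
  congr (\esum_(J in _) _); apply/seteqP; split=> J /=;
    rewrite /avoiding_sets /= fdisjointXU fdisjointX1.
    by move=> [[-> ->] ->].
  by move=> [-> /andP[-> ->]].
rewrite -ge0_esumZl //; last by move=> J; exact: prod_ge0.
rewrite (reindex_esum (avoiding_sets (i |` D) k) _ (fun J => i |` J)).
  apply: eq_esum => J [_]; rewrite fdisjointXU fdisjointX1 => /andP[iJ _].
  by rewrite big_fsetU1 //= EFinM.
split=> [J|J J'|J] /=.
- rewrite /avoiding_sets /= fdisjointXU fdisjointX1 => -[<- /andP[iJ JD]].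
  rewrite cardfsU1 iJ add1n fdisjointU1X iD JD; split=> //.
  by rewrite !inE eqxx.
- rewrite !in_setE /avoiding_sets /= !fdisjointXU !fdisjointX1.
  move=> [_ /andP[iJ _]] [_ /andP[iJ' _]] /(congr1 (fun A => A `\ i)).
  by rewrite !fsetU1K.
- move=> [[cJ JD] /negP]; rewrite negbK => iJ; exists (J `\ i).
    rewrite /avoiding_sets /= fdisjointXU fdisjointX1 !inE eqxx /=; split.
      by move: cJ; rewrite (cardfsD1 i) iJ => -[].
    exact: fdisjointWl (fsubD1set _ _) JD.
  by rewrite fsetD1K.
Qed.

(** The ratio of P(Y = i) to [p i ^+ 2]. *)
Definition repeat_weight i : \bar R :=
  \sum_(0 <= k <oo) ((k.+1)`!%:R)%:E * elem_sym [fset i] k.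

Lemma lawY_weight i : lawY p i = (p i ^+ 2)%:E * repeat_weight i.
Proof.
rewrite /lawY /repeat_weight /elem_sym; congr (_ * _).
apply: eq_eseriesr => k _; congr (_ * _); congr (\esum_(J in _) _).
by apply/seteqP; split=> J; rewrite /avoiding_sets /= fdisjointX1.
Qed.

Lemma fact_elem_sym_ge0 n D k : 0 <= (n`!%:R)%:E * elem_sym D k.
Proof. by rewrite mule_ge0 ?elem_sym_ge0 // lee_fin. Qed.

(** Both series are symmetric in [i] and [j]: the only asymmetry between the
    weights of two colors is the coefficient [p j].  The isolated 1 is the term
    [k = 0], in which no other color has been seen. *)
Lemma repeat_weightE i j : i != j ->
  repeat_weight i =
    (1 + \sum_(0 <= k <oo) ((k.+2)`!%:R)%:E * elem_sym [fset i; j] k.+1) +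
    (p j)%:E * \sum_(0 <= k <oo) ((k.+2)`!%:R)%:E * elem_sym [fset i; j] k.
Proof.
move=> ij; rewrite /repeat_weight nneseries_recl//; last first.
  by move=> k _; exact: fact_elem_sym_ge0.
rewrite elem_sym0 mule1 -addeA; congr (_ + _).
rewrite -nneseries_addn; last by move=> k; exact: fact_elem_sym_ge0.
rewrite -nneseriesZl; last by move=> k _; exact: fact_elem_sym_ge0.
rewrite -nneseriesD; first last.
- by move=> k _ _; rewrite mule_ge0 ?fact_elem_sym_ge0 // lee_fin.
- by move=> k _ _; exact: fact_elem_sym_ge0.
apply: eq_eseriesr => k _; rewrite addn1 (@elem_symS _ j) ?inE 1?eq_sym //.
rewrite fsetUC ge0_muleDr ?mule_ge0 ?elem_sym_ge0 ?lee_fin //.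
by rewrite muleCA.
Qed.

(** The coefficient of [p j] in [repeat_weightE] is at least [2`!], and finite
    because the weight is, so it can be cancelled. *)
Lemma repeat_weight_inj i j : (0 < p i)%R ->
  repeat_weight j \is a fin_num -> repeat_weight i = repeat_weight j ->
  p i = p j.
Proof.
move=> pi0; have [->//|ij] := eqVneq i j.
rewrite (repeat_weightE ij) (@repeat_weightE j i) 1?eq_sym //.
rewrite [[fset j; i]]fsetUC.
move=> fin eqij; apply: (adde_mul_inj _ _ pi0 fin (esym eqij)).
  by rewrite adde_ge0 // nneseries_ge0 // => k _ _; exact: fact_elem_sym_ge0.
apply: (@lt_le_trans _ _
  (\sum_(0 <= k < 1) ((k.+2)`!%:R)%:E * elem_sym [fset i; j] k)).
  by rewrite big_nat1 elem_sym0 mule1 lte_fin ltr0n.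
by apply: nneseries_lim_ge => k _ _; exact: fact_elem_sym_ge0.
Qed.

End SymmetricSums.

(** * Uniform distributions *)

Section Uniform.
Variables (R : realType) (T : countType) (p : T -> R).
Hypothesis p_ge0 : forall i, (0 <= p i)%R.
Variables (S : {fset T}) (c : R).
Hypothesis pS : forall i, i \in S -> p i = c.
Hypothesis pNS : forall i, i \notin S -> p i = 0%R.

(** By induction on the number of colors of [S] outside [D]: [elem_symS] becomes
    Pascal's rule. *)
Lemma elem_sym_uniform D k :
  elem_sym p D k = ('C(#|` S `\` D|, k)%:R * c ^+ k)%:E.
Proof.
move: {2}#|` _|%N (erefl #|` S `\` D|) => n.
elim: n D k => [|n IH] D [|k] Dn; rewrite ?elem_sym0 ?bin0 ?expr0 ?mulr1 // Dn.
  rewrite bin0n mul0r /elem_sym esum1 // => J [cJ JD].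
  have : J != fset0 by rewrite -cardfs_gt0 cJ.
  case/fset0Pn => j jJ; rewrite (big_fsetD1 j) //= pNS ?mul0r //.
  apply/negP => jS; have : j \in S `\` D.
    by rewrite inE jS andbT; move/fdisjointP: JD; apply.
  by rewrite (cardfs0_eq Dn) inE.
have : S `\` D != fset0 by rewrite -cardfs_gt0 Dn.
case/fset0Pn => i iSD; move: (iSD); rewrite inE => /andP[iD iS].
have Dn' : #|` S `\` (i |` D)| = n.
  by move: Dn; rewrite (cardfsD1 i) iSD fsetDDl fsetUC => -[].
rewrite (@elem_symS _ _ _ p_ge0 _ i) // !IH // Dn' pS // -EFinM -EFinD binS.
by rewrite natrD exprS; congr (_%:E); ring.
Qed.

End Uniform.

(** With [m = n.+1], the number [n ^_ k / m ^ k] is the probability that [k.+1]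
    draws from [m] equally likely colors are all distinct.  Each term is [m]
    times the decrease of this probability at the next draw, so the sum
    telescopes from 1 down to 0. *)
Lemma birthday_sum (R : numFieldType) n :
  (\sum_(0 <= k < n.+1) (k.+1)`!%:R * ('C(n, k)%:R * n.+1%:R ^- k) =
    n.+1%:R :> R)%R.
Proof.
set m : R := n.+1%:R%R.
have m0 : (m != 0)%R by rewrite pnatr_eq0.
(* The sign turns the decreasing probabilities into forward differences. *)
pose q k : R := (- ((n ^_ k)%:R * m ^- k))%R.
have step k : (k <= n)%N ->
    ((k.+1)`!%:R * ('C(n, k)%:R * m ^- k) = m * (q k.+1 - q k))%R.
  move=> kn; rewrite mulrA -natrM factS -mulnA [(k`! * _)%N]mulnC bin_ffact.
  rewrite /q ffactnSr !natrM natrB // exprSr invfM.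
  have -> : (n%:R = m - 1 :> R)%R by rewrite /m -natr1 addrK.
  by rewrite -natr1; field; rewrite addrC natr1 m0 expf_neq0.
rewrite (eq_big_nat _ _ (F2 := fun k => m * (q k.+1 - q k))%R); last first.
  by move=> k /andP[_ kn]; exact: step.
rewrite -mulr_sumr telescope_sumr // /q ffact_small // ffactn0 expr0 invr1.
by rewrite mul0r mulr1 oppr0 sub0r opprK mulr1.
Qed.

(** An infinite support would contain more than [c^-1] colors, of total mass
    above 1. *)
Lemma uniform_of_constant (R : realType) (T : countType) (p : T -> R) (c : R) :
    distribution_on p -> (forall i, support_of p i -> p i = c) ->
  uniform_distribution p.
Proof.
move=> [p0 p1] pc.
have supp : finite_set (support_of p).
  apply: contrapT => inf.
  have [i pi] : support_of p !=set0.
    by apply/set0P/eqP => S0; apply: inf; rewrite S0.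
  have c0 : (0 < c)%R by rewrite -(pc i pi) lt_def p0 andbT.
  have [B BS cB] := infinite_set_fset (Num.bound c^-1) inf.
  have : (#|` B|%:R * c)%:E <= \esum_(i in [set: T]) (p i)%:E.
    apply: esum_ge; exists [set` B]; first by split.
    rewrite fsbig_finite //= set_fsetK sumEFin lee_fin.
    rewrite big_seq (eq_bigr (fun=> c)) -?big_seq; last by move=> j /BS /pc.
    by rewrite big_const_seq count_predT iter_addr_0 mulr_natl.
  rewrite p1 lee_fin -ler_pdivlMr // div1r leNgt => /negP; apply.
  apply: (lt_le_trans (archi_boundP _)); first by rewrite invr_ge0 ltW.
  by rewrite ler_nat.
split=> // i pi; rewrite (pc i pi).
move: p1; rewrite (esum_finite_support supp) //; last first.
  by move=> j /negP; rewrite negbK => /eqP ->.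
rewrite sumEFin big_seq (eq_bigr (fun=> c)) -?big_seq; last first.
  by move=> j; rewrite in_fset_set // in_setE => /pc.
rewrite big_const_seq count_predT iter_addr_0 => -[].
rewrite -[(c *+ _)%R]mulr_natr; set m : R := (_%:R)%R => cm.
have m0 : (m != 0)%R.
  by apply/eqP => m0; move/eqP: cm; rewrite m0 mulr0 eq_sym oner_eq0.
by apply: (mulIf m0); rewrite cm mulVf.
Qed.

Lemma uniform_of_eq_laws (R : realType) (T : countType) (p : T -> R) :
    distribution_on p -> (forall i, lawX p i = lawY p i) ->
  uniform_distribution p.
Proof.
move=> hp XY; have [p0 _] := hp.
have [[i pi]|/set0P/negP] := pselect (support_of p !=set0); last first.
  rewrite negbK => /eqP S0; apply: (uniform_of_constant (c := 0%R)) => //.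
  by rewrite S0.
have pos j : support_of p j -> (0 < p j)%R by rewrite lt_def p0 andbT.
have M0 : 0 < match_prob p.
  apply: (@lt_le_trans _ _ (p i ^+ 2)%:E).
    by rewrite lte_fin exprn_gt0 ?pos.
  apply: esum_ge; exists [set i]; first by split.
  by rewrite fsbig_set1.
have Wfin j : support_of p j -> repeat_weight p j = (match_prob p)^-1.
  move=> pj; have := XY j; rewrite lawY_weight /lawX => e.
  have p2 : (0 < p j ^+ 2)%R by rewrite exprn_gt0 ?pos.
  exact: (esym (pmule_inj p2 e)).
apply: (uniform_of_constant (c := p i)) => // j pj.
apply: (repeat_weight_inj p0); rewrite ?pos // !Wfin //.
rewrite ge0_fin_numE ?inve_ge0 ?ltW // ltey inve_eqy.
by rewrite gt_eqF.
Qed.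

Lemma eq_laws_of_uniform (R : realType) (T : countType) (p : T -> R) i :
    (forall j, (0 <= p j)%R) -> uniform_distribution p ->
  lawX p i = lawY p i.
Proof.
move=> p0 [Sfin punif].
have [i0|pi] := eqVneq (p i) 0%R.
  by rewrite /lawX lawY_weight i0 expr0n /= !mul0e.
set S := fset_set (support_of p) in punif *.
have SP j : (j \in S) = (p j != 0%R).
  by rewrite in_fset_set //; apply/idP/idP; rewrite in_setE.
set m := #|` S| in punif *.
have pS j : j \in S -> p j = (m%:R^-1)%R by rewrite SP => /punif.
have pNS j : j \notin S -> p j = 0%R by rewrite SP negbK => /eqP.
have iS : i \in S by rewrite SP.
have mE : m = (#|` S `\` [fset i]|).+1 by rewrite /m (cardfsD1 i) iS.
have m0 : (m%:R != 0 :> R)%R by rewrite pnatr_eq0 mE.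
have ME : match_prob p = (m%:R^-1)%:E.
  rewrite /match_prob (esum_finite_support Sfin); first last.
  - by move=> j /negP; rewrite negbK => /eqP ->; rewrite expr0n.
  - by move=> j; rewrite lee_fin sqr_ge0.
  rewrite sumEFin big_seq (eq_bigr (fun=> m%:R^-1 ^+ 2)%R) -?big_seq; last first.
    by move=> j /pS ->.
  rewrite big_const_seq count_predT iter_addr_0 -mulr_natr; congr (_%:E).
  by rewrite -/S -/m; field.
have WE : repeat_weight p i = m%:R%:E.
  rewrite /repeat_weight (nneseries_split _ m); last first.
    by move=> k _; exact: fact_elem_sym_ge0.
  rewrite add0n [X in _ + X]eseries0 ?adde0; last first.
    move=> k mk _; rewrite (elem_sym_uniform p0 pS pNS) bin_small -?mE //.
    by rewrite mul0r mule0.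
  rewrite mE -[in RHS](birthday_sum R) -sumEFin; apply: eq_bigr => k _.
  by rewrite (elem_sym_uniform p0 pS pNS) -EFinM -mE exprVn.
by rewrite /lawX lawY_weight ME WE pS // inver invr_eq0 (negPf m0) invrK.
Qed.

Theorem theorem1 (R : realType) (T : countType) (p : T -> R)
    (hp : distribution_on p) :
  (forall i : T, lawX p i = lawY p i) <-> uniform_distribution p.
Proof.
split=> [|punif i]; first exact: uniform_of_eq_laws.
by apply: eq_laws_of_uniform => //; exact: hp.1.
Qed.
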